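(* Let $M$ be a smooth manifold with a $C^0$ semi-Riemannian metric $g$. Let $F$ be a $(0,2)$-tensor field on $M$ of regularity $C^0$ such that $F(\mathbf{v},\mathbf{v})\ge 0$ for all null vectors $\mathbf{v}\in TM$. Then for each compact subset $Z\subseteq M$ there is a constant $C_Z\in\mathbb{R}$ such that $$F(\mathbf{v},\mathbf{v})\ \ge\ C_Z\cdot |g(\mathbf{v},\mathbf{v})|\qquad\text{for all } \mathbf{v}\in TM|_Z .$$
   Context: A $C^0$ semi-Riemannian metric is a continuous symmetric $(0,2)$-tensor field that is non-degenerate at each point with constant signature (any signature is allowed). A vector $\mathbf{v}\in TM$ is null if $g(\mathbf{v},\mathbf{v})=0$. $TM|_Z$ denotes the set of all tangent vectors of $M$ with base point in $Z$. *)

(* Defs.v *)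
From HB Require Import structures.
From mathcomp Require Import all_boot all_order all_algebra.
From mathcomp Require Import all_classical all_reals all_analysis.

Set Implicit Arguments.
Unset Strict Implicit.
Unset Printing Implicit Defensive.

Import Order.TTheory GRing.Theory Num.Theory.
Import numFieldNormedType.Exports.

Local Open Scope classical_set_scope.
Local Open Scope ring_scope.

(** Functions are total: only the values of [f] on the open set [U] matter.
    In finite dimension, [x |-> 'd f x] is of class C^k if and only if
    [x |-> 'd f x v] is, for every fixed [v]. *)
Fixpoint Ck_on (R : realType) (V W : normedModType R) (k : nat) (U : set V)
    (f : V -> W) : Prop :=
  match k with
  | 0 => forall x, U x -> {for x, continuous f}
  | k.+1 => (forall x, U x -> differentiable f x) /\
            (forall v, Ck_on k U (fun x => 'd f x v))
  end.

Definition smooth_on (R : realType) (V W : normedModType R) (U : set V)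
    (f : V -> W) : Prop := forall k, Ck_on k U f.

(** [chart_map] and [chart_inv] are only meaningful on [chart_dom] and on
    [chart_cod] respectively; their values elsewhere are irrelevant. *)
Record chart (R : realType) (n : nat) (M : topologicalType) : Type := Chart {
  chart_dom : set M ;
  chart_map :> M -> 'rV[R]_n ;
  chart_inv : 'rV[R]_n -> M ;
  chart_cod := chart_map @` chart_dom ;
  chart_dom_open : open chart_dom ;
  chart_cod_open : open chart_cod ;
  chart_mapK : forall p, chart_dom p -> chart_inv (chart_map p) = p ;
  chart_map_continuous : {within chart_dom, continuous chart_map} ;
  chart_inv_continuous : {within chart_cod, continuous chart_inv} }.

Definition transition (R : realType) (n : nat) (M : topologicalType)
    (a b : chart R n M) : 'rV[R]_n -> 'rV[R]_n := b \o chart_inv a.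

(** The smooth structure is the one generated by [atlas], which is not
    required to be maximal. *)
Record smooth_manifold (R : realType) (n : nat) : Type := SmoothManifold {
  manifold_carrier :> topologicalType ;
  manifold_hausdorff : hausdorff_space manifold_carrier ;
  manifold_second_countable : @second_countable manifold_carrier ;
  atlas : set (chart R n manifold_carrier) ;
  atlas_cover : forall p, exists2 a, atlas a & chart_dom a p ;
  atlas_smooth : forall a b, atlas a -> atlas b ->
    smooth_on (a @` (chart_dom a `&` chart_dom b)) (transition a b) }.

Lemma near_eq_diff (R : realType) (V W : normedModType R) (f g : V -> W)
    (x u : V) : differentiable f x -> differentiable g x ->
  (\near x, f x = g x) -> 'd f x u = 'd g x u.
Proof.
move=> df dg fg; rewrite -(deriveE u df) -(deriveE u dg).
exact: near_eq_derive.
Qed.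

Section tangent_space.
Context {R : realType} {n : nat} {M : smooth_manifold R n}.
Implicit Types (p : M) (a b c : chart R n M).

Definition chart_at p : set (chart R n M) :=
  [set a | atlas a /\ chart_dom a p].

(** A tangent vector at [p] is the family of its component vectors in the
    charts of the atlas around [p], related by the differentials of the
    transition maps; the entries at all other charts are [0]. *)
Definition is_tangent p (v : chart R n M -> 'rV[R]_n) : Prop :=
  (forall a, ~ chart_at p a -> v a = 0) /\
  (forall a b, chart_at p a -> chart_at p b ->
     v b = 'd (transition a b) (a p) (v a)).

Definition tangent_pred p : {pred (chart R n M -> 'rV[R]_n)} :=
  fun v => `[< is_tangent p v >].

Lemma tangent_submod_closed p : submod_closed (tangent_pred p).
Proof.
split=> [|k u v /asboolP[u0 uT] /asboolP[v0 vT]]; apply/asboolP; split.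
- by [].
- by move=> a b _ _; rewrite linear0.
- move=> a pa; rewrite -[LHS]/(k *: u a + v a).
  by rewrite u0 // v0 // scaler0 addr0.
- move=> a b pa pb; rewrite -[LHS]/(k *: u b + v b).
  by rewrite (uT a b) // (vT a b) // -linearP.
Qed.

HB.instance Definition _ p :=
  GRing.isSubmodClosed.Build R (chart R n M -> 'rV[R]_n) (tangent_pred p)
    (tangent_submod_closed p).

Record tangent_space p : Type := TangentVector {
  component :> chart R n M -> 'rV[R]_n ;
  componentP : component \in tangent_pred p }.

HB.instance Definition _ p := [isSub for @component p].
HB.instance Definition _ p := [Choice of tangent_space p by <:].
HB.instance Definition _ p := [SubChoice_isSubLmodule of tangent_space p by <:].


Lemma chart_inv_near a p (A : set M) : chart_dom a p -> nbhs p A ->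
  \forall x \near a p, A (chart_inv a x).
Proof.
move=> ap pA; have := @chart_inv_continuous _ _ _ a.
rewrite continuous_open_subspace; last exact: chart_cod_open.
move/(_ (a p)); rewrite inE => /(_ (ex_intro2 _ _ p ap erefl)).
by apply; rewrite chart_mapK.
Qed.

Lemma chart_dom_near a p : chart_dom a p -> \forall q \near p, chart_dom a q.
Proof. by move=> ap; apply: open_nbhs_nbhs; split => //; exact: chart_dom_open. Qed.

Lemma transition_differentiable p a b : chart_at p a -> chart_at p b ->
  differentiable (transition a b) (a p).
Proof.
by move=> [Aa ap] [Ab bp]; have [+ _] := atlas_smooth Aa Ab 1; apply; exists p.
Qed.

Lemma diff_transition_comp p a b c u :
  chart_at p a -> chart_at p b -> chart_at p c ->
  'd (transition a c) (a p) u =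
  'd (transition b c) (b p) ('d (transition a b) (a p) u).
Proof.
move=> pa pb pc; have [[_ ap] [_ bp]] := (pa, pb).
have abp : transition a b (a p) = b p by rewrite /transition /= chart_mapK.
have dab := transition_differentiable pa pb.
have dbc : differentiable (transition b c) (transition a b (a p)).
  by rewrite abp; exact: transition_differentiable.
have dac := transition_differentiable pa pc.
have dcomp := differentiable_comp dab dbc.
rewrite -abp -[RHS]/(('d (transition b c) (transition a b (a p)) \o
                      'd (transition a b) (a p)) u) -(diff_comp dab dbc).
apply: (near_eq_diff u dac dcomp).
have := chart_inv_near ap (chart_dom_near bp).
by apply: filterS => x bx; rewrite /transition /= chart_mapK.
Qed.

Lemma diff_transition_id p a u : chart_at p a -> 'd (transition a a) (a p) u = u.
Proof.
move=> pa; have daa := transition_differentiable pa pa.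
have did : differentiable (@id 'rV[R]_n) (a p) by exact: ex_diff.
rewrite (near_eq_diff u daa did); first by rewrite diff_val.
have acod : \forall x \near a p, chart_cod a x.
  apply: open_nbhs_nbhs; split; first exact: chart_cod_open.
  by exists p => //; case: pa.
by apply: filterS acod => x [q aq <-]; rewrite /transition /= chart_mapK.
Qed.

Definition coord_vector_family a p (u : 'rV[R]_n) : chart R n M -> 'rV[R]_n :=
  fun b => if `[< chart_at p a /\ chart_at p b >]
           then 'd (transition a b) (a p) u else 0.

Lemma coord_vector_subproof a p u : coord_vector_family a p u \in tangent_pred p.
Proof.
apply/asboolP; split=> [b|b c] pb.
  by rewrite /coord_vector_family; case: asboolP => // -[].
move=> pc; rewrite /coord_vector_family.
case: asboolP => [[pa _]|npa]; case: asboolP => [[pa' _]|npa'].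
- exact: diff_transition_comp.
- by case: npa'.
- by case: npa.
- by rewrite linear0.
Qed.

(** The tangent vector at [p] with component vector [u] in the chart [a]
    (and [0] if [p] is not in the domain of [a]). *)
Definition coord_vector a p u : tangent_space p :=
  TangentVector (coord_vector_subproof a p u).

Lemma coord_vectorE a p u : chart_at p a -> coord_vector a p u a = u.
Proof.
move=> pa; rewrite /coord_vector /= /coord_vector_family.
by case: asboolP => [_|[]//]; exact: diff_transition_id.
Qed.

Lemma coord_vectorK a p (v : tangent_space p) :
  chart_at p a -> coord_vector a p (v a) = v.
Proof.
move=> pa; apply: val_inj; apply/funext => b.
have /asboolP[v0 vT] := componentP v.
rewrite /= /coord_vector_family; case: asboolP => [[_ pb]|nb].
  by rewrite -vT.
by rewrite v0 // => pb; apply: nb.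
Qed.

End tangent_space.

Arguments tangent_space {R n} M p.

Definition is_basis (R : realType) (V : lmodType R) (m : nat) (e : 'I_m -> V) :
  Prop := forall v : V, exists! c : 'rV[R]_m, v = \sum_i c 0 i *: e i.

(** A form has signature [(r, s)] if it has an orthonormal basis with [r]
    vectors of square [1] followed by [s] vectors of square [-1]. *)
Definition has_signature (R : realType) (V : lmodType R) (B : V -> V -> R)
    (r s : nat) : Prop :=
  exists2 e : 'I_(r + s) -> V, is_basis e &
    forall i j, B (e i) (e j) =
      if i == j then (if (i < r)%N then 1 else -1) else 0.

Section tensors.
Context {R : realType} {n : nat} {M : smooth_manifold R n}.

Definition tensor02 : Type := forall p : M, {biscalar (tangent_space M p)}.

Implicit Types g F : tensor02.

Definition tensor_component (a : chart R n M) F (i j : 'I_n) (p : M) : R :=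
  F p (coord_vector a p (delta_mx 0 i)) (coord_vector a p (delta_mx 0 j)).

(** Continuity of the components in the charts of one atlas implies it in every
    chart of the smooth structure, since transition maps are C^1. *)
Definition C0_tensor F : Prop :=
  forall a, atlas a -> forall i j,
    {within chart_dom a, continuous (tensor_component a F i j)}.

Record C0_semi_riemannian_metric g : Prop := C0SemiRiemannianMetric {
  metric_C0 : C0_tensor g ;
  metric_symmetric : forall p (v w : tangent_space M p), g p v w = g p w v ;
  metric_nondegenerate : forall p (v : tangent_space M p),
    (forall w, g p v w = 0) -> v = 0 ;
  metric_signature : exists r s, forall p, has_signature (g p) r s }.

Definition null_vector g p (v : tangent_space M p) : Prop := g p v v = 0.

End tensors.
Arguments tensor02 {R n} M.

(* Main.v *)
(** By compactness of [Z] it suffices to bound [F] from below near each [p]. If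
    [g p] has no nonzero null vector, then [|F| <= C |g|] near [p], by
    compactness of the unit sphere of a chart. Otherwise [g p] takes both signs,
    say on [u] and [w], and keeps them on the vectors [u], [w] extended with
    constant components in a chart. If [g v v] and [g w w] have opposite signs,
    two null vectors on the line [v + t w] give
    [F v v >= g v v * (F w w / g w w)], where the ratio is bounded near [p];
    the other sign of [g v v] is handled by [u]. *)
From HB Require Import structures.
Require Import Defs.
From mathcomp Require Import all_boot all_order all_algebra.
From mathcomp Require Import all_classical all_reals all_analysis.
From mathcomp Require Import ring lra.
Import Order.TTheory GRing.Theory Num.Theory.
Import numFieldNormedType.Exports.
Local Open Scope classical_set_scope.
Local Open Scope ring_scope.

Lemma biscalar_quadraticD (R : realType) (V : lmodType R) (B : {biscalar V})
    (v w : V) (t : R) :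
  B (v + t *: w) (v + t *: w) = B v v + t * (B v w + B w v) + t ^+ 2 * B w w.
Proof.
rewrite linearDl !linearDr !linearZl_LR !linearZr_LR.
rewrite /=; ring.
Qed.

(** On the line [z + t v] the form is affine in [t] with slope [2 * g z v], which is nonzero, so it
    takes every real value. *)
Lemma isotropic_indefinite (R : realType) (V : lmodType R) (g : {biscalar V})
    (v z : V) :
  (forall v w, g v w = g w v) -> g v v = 0 -> g z v != 0 ->
  (exists u, 0 < g u u) /\ (exists w, g w w < 0).
Proof.
move=> gC gv gzv.
have val (r : R) : exists u, g u u = r.
  exists (z + ((r - g z z) / (2 * g z v)) *: v).
  by rewrite biscalar_quadraticD gv (gC v z); field.
have [u hu] := val 1; have [w hw] := val (-1).
by split; [exists u; rewrite hu | exists w; rewrite hw oppr_lt0].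
Qed.

(* The line [v + t w] meets the null cone of [g] at the two roots [t1], [t2] of
   a quadratic, which have opposite signs; averaging [0 <= F] at these
   points with the weights that cancel the linear term in [t] leaves
   [0 <= F v v - t1 t2 F w w], and [t1 t2 = g v v / g w w]. *)
Lemma null_nonneg_lower_bound (R : realType) (V : lmodType R)
    (g F : {biscalar V}) (v w : V) :
  (forall x, g x x = 0 -> 0 <= F x x) -> g v v * g w w < 0 ->
  g v v * (F w w / g w w) <= F v v.
Proof.
move=> F0 vw.
set a := g w w in vw *; set c := g v v in vw *.
set b := (g v w + g w v) / 2.
have a0 : a != 0 by apply: contraTneq vw => ->; rewrite mulr0 ltxx.
set s := Num.sqrt (b ^+ 2 - c * a).
have s2 : s ^+ 2 = b ^+ 2 - c * a.
  by rewrite sqr_sqrtr // subr_ge0 (le_trans (ltW vw)) // sqr_ge0.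
(* As [c * a < 0], the discriminant exceeds [b ^+ 2]; hence the averaging weights [s + b] and
   [s - b] are positive. *)
have sb : `|b| < s by rewrite -sqrtr_sqr ltr_sqrt; nra.
have [sb1 sb2] : 0 < s + b /\ 0 < s - b.
  by move: sb; rewrite ltr_norml => /andP[]; lra.
have caE : c = (b ^+ 2 - s ^+ 2) / a by rewrite s2; field.
have gE t : g (v + t *: w) (v + t *: w) = c + t * (2 * b) + t ^+ 2 * a.
  by rewrite biscalar_quadraticD /b -/a -/c; field.
pose t1 := (- b + s) / a; pose t2 := (- b - s) / a.
have F1 : 0 <= F (v + t1 *: w) (v + t1 *: w).
  by apply: F0; rewrite gE caE /t1; field.
have F2 : 0 <= F (v + t2 *: w) (v + t2 *: w).
  by apply: F0; rewrite gE caE /t2; field.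
have : 0 <= (s + b) * F (v + t1 *: w) (v + t1 *: w) +
            (s - b) * F (v + t2 *: w) (v + t2 *: w).
  by rewrite addr_ge0 // mulr_ge0 // ltW.
rewrite !biscalar_quadraticD => comb.
rewrite -subr_ge0 -(pmulr_rge0 _ (_ : 0 < 2 * s)); last by lra.
apply: le_trans comb _; rewrite le_eqVlt; apply/orP; left; apply/eqP.
by rewrite caE /t1 /t2; field.
Qed.

(** Near [t], [|f|] stays above half its value at [t] and [|h|] below its value plus 1, so the
    quotient of these bounds serves as [C]. Letting [C] tend to [+oo] jointly with [t'] suits
    near-covering compactness, which then needs no maximum of finitely many constants. *)
Lemma near_bounded_ratio (R : realType) (T : topologicalType) (f h : T -> R)
    (t : T) :
  {for t, continuous f} -> {for t, continuous h} -> f t != 0 ->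
  \forall t' \near t & C \near +oo, `|h t'| <= C * `|f t'|.
Proof.
move=> cf ch ft0.
have f2 : 0 < `|f t| / 2 by rewrite divr_gt0 // normr_gt0.
have nf : \forall t' \near t, `|f t| / 2 < `|f t'|.
  apply: (cvgr_norm_gt _ cf); rewrite ltr_pdivrMr // ltr_pMr ?normr_gt0 //.
  by rewrite ltr1n.
have nh : \forall t' \near t, `|h t'| < `|h t| + 1.
  by apply: (cvgr_norm_lt _ ch); rewrite ltrDl.
have nC : \forall C \near (+oo : set_system R), (`|h t| + 1) / (`|f t| / 2) <= C.
  exact: nbhs_pinfty_ge (num_real _).
near=> t' C.
have A : `|f t| / 2 < `|f t'| by near: t'.
have B : `|h t'| < `|h t| + 1 by near: t'.
have D : (`|h t| + 1) / (`|f t| / 2) <= C by near: C.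
have C0 : 0 <= C by apply: le_trans D; rewrite divr_ge0 ?addr_ge0 // ltW.
rewrite ler_pdivrMr // in D.
exact: le_trans (ltW B) (le_trans D (ler_wpM2l C0 (ltW A))).
Unshelve. all: by end_near. Qed.

Section tensor_components.
Context {R : realType} {n : nat} {M : smooth_manifold R n}.
Implicit Types (a : chart R n M) (p q : M) (B g F : tensor02 M).

Lemma coord_vector_is_linear a p : linear (@coord_vector R n M a p).
Proof.
move=> k u v; apply: val_inj; apply/funext => b.
rewrite -[RHS]/(k *: coord_vector a p u b + coord_vector a p v b) /=.
rewrite /coord_vector_family; case: asboolP => _; first by rewrite linearP.
by rewrite scaler0 addr0.
Qed.

HB.instance Definition _ a p :=
  GRing.isLinear.Build R 'rV[R]_n (tangent_space M p) *:%R
    (@coord_vector R n M a p) (coord_vector_is_linear a p).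

Lemma coord_vectorZ a p k x :
  coord_vector a p (k *: x) = k *: coord_vector a p x.
Proof. exact: linearZZ. Qed.

Lemma coord_vector_sum_delta a p x :
  coord_vector a p x = \sum_i x 0 i *: coord_vector a p 'e_i.
Proof.
rewrite {1}[x]row_sum_delta raddf_sum.
by apply: eq_bigr => i _; exact: coord_vectorZ.
Qed.

(** The fibre [tangent_space M q] varies with [q]; replacing the vector by its components in [a]
    gives a function on a product space, whose joint continuity can be stated. *)
Definition coord_quadratic a B (y : M * 'rV[R]_n) : R :=
  B y.1 (coord_vector a y.1 y.2) (coord_vector a y.1 y.2).

Lemma coord_quadraticE a B p x : coord_quadratic a B (p, x) =
  \sum_i \sum_j x 0 i * x 0 j * tensor_component a B i j p.
Proof.
rewrite /coord_quadratic /= (coord_vector_sum_delta a p x).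
rewrite linear_sumlz; apply: eq_bigr => i _.
rewrite linear_sumr; apply: eq_bigr => j _.
rewrite linearZl_LR linearZr_LR /tensor_component.
by rewrite /= mulrA.
Qed.

Lemma coord_quadraticZ a B p k x :
  coord_quadratic a B (p, k *: x) = k ^+ 2 * coord_quadratic a B (p, x).
Proof.
rewrite /coord_quadratic /= coord_vectorZ linearZl_LR linearZr_LR.
by rewrite /= mulrA.
Qed.

Lemma coord_quadratic_continuous a B p x : C0_tensor B -> chart_at p a ->
  {for (p, x), continuous (coord_quadratic a B)}.
Proof.
move=> cB [Aa ap].
have -> : coord_quadratic a B = fun y =>
    \sum_i \sum_j y.2 0 i * y.2 0 j * tensor_component a B i j y.1.
  by apply/funext => -[q z]; rewrite coord_quadraticE.
have cc (k : 'I_n) : (y.2 : 'rV[R]_n) 0 k @[y --> (p, x)] --> x 0 k.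
  apply: (@cvg_comp _ _ _ snd (fun z : 'rV[R]_n => z 0 k) _ (nbhs x)).
    exact: cvg_snd.
  exact: coord_continuous.
apply: cvg_big => [|i _]; first exact: add_continuous.
apply: cvg_big => [|j _]; first exact: add_continuous.
apply: cvgM; first by apply: cvgM; exact: cc.
apply: (@cvg_comp _ _ _ fst (tensor_component a B i j) _ (nbhs p)).
  exact: cvg_fst.
have := cB a Aa i j; rewrite continuous_open_subspace; last exact: chart_dom_open.
by apply; rewrite inE.
Qed.

Lemma coord_quadratic_component a B p (v : tangent_space M p) :
  chart_at p a -> coord_quadratic a B (p, v a) = B p v v.
Proof. by move=> pa; rewrite /coord_quadratic /= coord_vectorK. Qed.

Lemma near_chart_at a p : chart_at p a -> \forall q \near p, chart_at q a.
Proof. by move=> [Aa /chart_dom_near]; apply: filterS => q. Qed.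

(** With the sign [- C] the condition weakens as [C] grows, so it can be asked for all large [C]. *)
Definition lower_bounded g F p (C : R) : Prop :=
  forall v : tangent_space M p, - C * `|g p v v| <= F p v v.

Lemma near_lower_bounded_anisotropic g F p : C0_tensor g -> C0_tensor F ->
  (forall v : tangent_space M p, g p v v = 0 -> v = 0) ->
  \forall q \near p & C \near +oo, lower_bounded g F q C.
Proof.
move=> cg cF gp0; have [a Aa ap] := atlas_cover p.
have pa : chart_at p a by [].
pose S := [set x : 'rV[R]_n | `|x| = 1].
have cS : compact S.
  apply: bounded_closed_compact.
    by exists 1; split => // y y1 x Sx; rewrite /= Sx ltW.
  rewrite (_ : S = (fun x : 'rV[R]_n => `|x|) @^-1` [set 1]) //.
  apply: closed_comp; last exact: closed_eq.
  by move=> x _; exact: norm_continuous.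
pose P (qC : M * R) (x : 'rV[R]_n) :=
  `|coord_quadratic a F (qC.1, x)| <= qC.2 * `|coord_quadratic a g (qC.1, x)|.
(* Compactness of the sphere, with [(q, C)] as parameter, yields one neighbourhood of [p] and one
   range of [C] valid for all unit vectors. *)
have : \forall qC \near (nbhs p, +oo : set_system R), S `<=` P qC.
  move/compact_near_coveringP: cS => cS.
  apply: (cS _ (filter_prod (nbhs p) +oo) P) => x Sx.
  have gx0 : coord_quadratic a g (p, x) != 0.
    apply/eqP => /gp0 /(congr1 (fun v : tangent_space M p => v a)).
    rewrite /= -[LHS]/(coord_vector a p x a) coord_vectorE // => x0.
    by move: Sx; rewrite /S /= x0 normr0 => /esym/eqP; rewrite oner_eq0.
  have := near_bounded_ratio _ _ _ _ _
    (coord_quadratic_continuous a g p x cg pa)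
    (coord_quadratic_continuous a F p x cF pa) gx0.
  (* Regroup the neighbourhoods from [((q, x'), C)] to [(x', (q, C))]. *)
  move=> [[A D] /= [[[U W] /= [nU nW] UW] nD]] AD.
  exists (W, U `*` D) => /=; first by split => //; exists (U, D).
  move=> [x' [q C]] /= [Wx' [Uq DC]].
  by apply: (AD ((q, x'), C)); split => //=; apply: UW.
move=> nS; have npa := near_chart_at a p pa.
have npa' : \forall qC \near (nbhs p, +oo : set_system R), chart_at qC.1 a.
  by apply: cvg_fst npa.
apply: filterS2 npa' nS => -[q C] /= qa qS v.
rewrite -!(coord_quadratic_component a) //.
set x := v a; have [->|x0] := eqVneq x 0.
  rewrite -(scale0r (0 : 'rV[R]_n)) !coord_quadraticZ.
  by rewrite expr0n /= !mul0r normr0 mulr0.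
(* Both sides are homogeneous of degree 2, so the estimate on the unit sphere extends to [x]. *)
have := qS (`|x|^-1 *: x); rewrite /S /= normrZ normfV normr_id.
rewrite mulVf ?normr_eq0 // => /(_ erefl).
have k0 : 0 < `|x|^-1 ^+ 2 by rewrite exprn_gt0 // invr_gt0 normr_gt0.
rewrite /P /= !coord_quadraticZ; move: k0; set k := _ ^+ 2 => k0.
rewrite !(normrM k) (gtr0_norm k0) mulrCA ler_pM2l //.
by rewrite mulNr ler_norml => /andP[].
Qed.

Lemma near_lower_bounded_indefinite g F p : C0_tensor g -> C0_tensor F ->
  (forall q (v : tangent_space M q), null_vector g v -> 0 <= F q v v) ->
  (exists u, 0 < g p u u) -> (exists w, g p w w < 0) ->
  \forall q \near p & C \near +oo, lower_bounded g F q C.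
Proof.
move=> cg cF gF [u gu] [w gw]; have [a Aa ap] := atlas_cover p.
have pa : chart_at p a by [].
(* The components [x] stay fixed while the base point moves: this extends [u] and [w] to nearby
   points. *)
have slice B x : C0_tensor B ->
    {for p, continuous (fun q => coord_quadratic a B (q, x))}.
  move=> cB; have cx : {for p, continuous (fun q : M => (q, x))}.
    by apply: (@cvg_pair _ _ _ (nbhs p) (nbhs p) (nbhs x));
      [exact: cvg_id | exact: cvg_cst].
  by apply: (continuous_comp cx); exact: coord_quadratic_continuous.
move: gu gw; rewrite -!(coord_quadratic_component a) // => gu gw.
have bu := near_bounded_ratio _ _ _ _ _ (slice g (u a) cg)
  (slice F (u a) cF) (lt0r_neq0 gu).
have bw := near_bounded_ratio _ _ _ _ _ (slice g (w a) cg)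
  (slice F (w a) cF) (ltr0_neq0 gw).
have pu : \forall q \near p, 0 < coord_quadratic a g (q, u a).
  exact: cvgr_gt (slice g (u a) cg) _ gu.
have pw : \forall q \near p, coord_quadratic a g (q, w a) < 0.
  exact: cvgr_lt (slice g (w a) cg) _ gw.
have fst_near (P : set M) : nbhs p P ->
    \forall qC \near (nbhs p, +oo : set_system R), P qC.1 by apply: cvg_fst.
apply: filterS2 (filterI bu bw) (filterI (fst_near _ pu) (fst_near _ pw)).
move=> [q C] /= [{}bu {}bw] [{}pu {}pw] v.
(* Here [x] is whichever of [u a] and [w a] has [g]-square of sign opposite to that of [v]. *)
have bound x : g q v v * coord_quadratic a g (q, x) < 0 ->
    `|coord_quadratic a F (q, x)| <= C * `|coord_quadratic a g (q, x)| ->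
    - C * `|g q v v| <= F q v v.
  move=> vx bx; have gx0 : coord_quadratic a g (q, x) != 0.
    by apply: contraTneq vx => ->; rewrite mulr0 ltxx.
  apply: le_trans (null_nonneg_lower_bound _ _ _ _ _ _ (gF q) vx).
  rewrite mulNr lerNl -mulrN; apply: le_trans (ler_norm _) _.
  rewrite normrM normrN normrM normfV mulrC ler_wpM2r //.
  by rewrite ler_pdivrMr ?normr_gt0.
have [gv|gv|gv] := ltgtP (g q v v) 0.
- by apply: (bound (u a)) => //; rewrite nmulr_rlt0.
- by apply: (bound (w a)) => //; rewrite pmulr_rlt0.
- by rewrite gv normr0 mulr0 gF.
Qed.

Lemma near_lower_bounded g F p : C0_semi_riemannian_metric g -> C0_tensor F ->
  (forall q (v : tangent_space M q), null_vector g v -> 0 <= F q v v) ->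
  \forall q \near p & C \near +oo, lower_bounded g F q C.
Proof.
move=> [cg gC gnd _] cF gF.
have [gp0|] := pselect (forall v : tangent_space M p, g p v v = 0 -> v = 0).
  exact: near_lower_bounded_anisotropic.
move=> /existsNP[v /not_implyP[gv v0]].
(* Nondegeneracy pairs the nonzero null vector [v] nontrivially with some [z], so [g p] takes both
   signs. *)
have /existsNP[z /eqP gvz] : ~ forall z, g p v z = 0 by move/gnd.
rewrite gC in gvz.
have [pos neg] := isotropic_indefinite _ _ _ _ _ (gC p) gv gvz.
exact: near_lower_bounded_indefinite.
Qed.

End tensor_components.

Theorem theorem2p1 (R : realType) (n : nat) (M : smooth_manifold R n)
    (g F : tensor02 M) (hg : C0_semi_riemannian_metric g) (hF : C0_tensor F)
    (hnull : forall (p : M) (v : tangent_space M p),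
      null_vector g v -> 0 <= F p v v)
    (Z : set M) (hZ : compact Z) :
  exists C_Z : R, forall p : M, Z p -> forall v : tangent_space M p,
    C_Z * `|g p v v| <= F p v v.
Proof.
(* The local bounds hold for all large [C], so compactness of [Z] gives a common [C]. *)
have : \forall C \near (+oo : set_system R),
    Z `<=` (fun p => lower_bounded g F p C).
  move/compact_near_coveringP: hZ; apply => p _.
  exact: near_lower_bounded.
by move=> /filter_ex[C ZC]; exists (- C).
Qed.
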